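(* Let $\mathcal{M}=(Q,A,\tau)$ be a bi-reversible Mealy automaton and let $u,v\in A^*$ with $v$ nonempty. Then the set of all (finite) prefixes of elements of $Q^*\cdot uv^{\omega}$ forms a regular language.
   Context: A Mealy automaton is a tuple $\mathcal{M}=(Q,A,\tau)$ where $Q$ (states) and $A$ (alphabet) are finite sets and $\tau\colon Q\times A\to A\times Q$ is a map; write $\tau(q,a)=(q\cdot a,\,q@a)$. It is invertible if for every $q\in Q$ the map $a\mapsto q\cdot a$ is a bijection of $A$, reversible if for every $a\in A$ the map $q\mapsto q@a$ is a bijection of $Q$, and bi-reversible if it is invertible, reversible and $\tau$ is a bijection. $Q^*$ and $A^*$ denote the free monoids (finite words, with empty word $\epsilon$). The operations extend uniquely to a left action $\cdot$ of $Q^*$ on the set $A^*$ and a right action $@$ of $A^*$ on the set $Q^*$ by: $s\cdot\epsilon=\epsilon$, $s@\epsilon=s$, $\epsilon\cdot u=u$, $\epsilon@u=\epsilon$, $s\cdot(uv)=(s\cdot u)\,((s@u)\cdot v)$, $s@(uv)=(s@u)@v$, $(st)\cdot u=s\cdot(t\cdot u)$, $(st)@u=(s@(t\cdot u))\,(t@u)$. The action $\cdot$ preserves lengths and is compatible with prefixes, hence extends to the set $A^\omega$ of right-infinite words. $v^\omega=vvv\cdots$, $uv^\omega$ is the concatenation of $u$ and $v^\omega$, and $Q^*\cdot uv^\omega$ is the orbit $\{g\cdot uv^\omega\mid g\in Q^*\}$. *)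

(* Defs.v *)
From mathcomp Require Import all_boot.

Set Implicit Arguments.
Unset Strict Implicit.
Unset Printing Implicit Defensive.

(* The transition map tau, with tau (q, a) = (q . a, q @ a). *)
Definition mealy (Q A : finType) := Q * A -> A * Q.

Section Mealy.
Variables (Q A : finType) (M : mealy Q A).

Definition out (q : Q) (a : A) : A := (M (q, a)).1.
Definition step (q : Q) (a : A) : Q := (M (q, a)).2.

Definition invertible : Prop := forall q : Q, bijective (fun a => out q a).
Definition reversible : Prop := forall a : A, bijective (fun q => step q a).
Definition bireversible : Prop := [/\ invertible, reversible & bijective M].

(* q . u and q @ u for a single state q *)
Fixpoint act1 (q : Q) (u : seq A) : seq A :=
  if u is a :: u' then out q a :: act1 (step q a) u' else [::].
Definition res1 (q : Q) (u : seq A) : Q := foldl step q u.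

(* s . u and s @ u : the last letter of s acts first *)
Definition act (s : seq Q) (u : seq A) : seq A := foldr act1 u s.
Fixpoint res (s : seq Q) (u : seq A) : seq Q :=
  if s is q :: t then res1 q (act t u) :: res t u else [::].

(* The action on right-infinite words: the length-n prefix of s . w is
   s . (length-n prefix of w), see [act_inf_prefix]. The default [w n] of
   [nth] is never used. *)
Definition act_inf (s : seq Q) (w : nat -> A) : nat -> A :=
  fun n => nth (w n) (act s (mkseq w n.+1)) n.

Definition orbit_inf (w : nat -> A) : (nat -> A) -> Prop :=
  fun x => exists g : seq Q, x = act_inf g w.

(* The identities that determine the two actions. *)

Lemma act1_cat q u v : act1 q (u ++ v) = act1 q u ++ act1 (res1 q u) v.
Proof. by elim: u q => //= a u IH q; rewrite IH. Qed.

Lemma act_letter q a : act [:: q] [:: a] = [:: out q a].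
Proof. by []. Qed.

Lemma res_letter q a : res [:: q] [:: a] = [:: step q a].
Proof. by []. Qed.

Lemma act_nil_r s : act s [::] = [::].
Proof. by elim: s => //= q s ->. Qed.

Lemma res_nil_r s : res s [::] = s.
Proof. by elim: s => //= q s ->; rewrite act_nil_r. Qed.

Lemma act_nil_l u : act [::] u = u.
Proof. by []. Qed.

Lemma res_nil_l u : res [::] u = [::].
Proof. by []. Qed.

Lemma act_cat_r s u v : act s (u ++ v) = act s u ++ act (res s u) v.
Proof. by elim: s => //= q s ->; rewrite act1_cat. Qed.

Lemma res_cat_r s u v : res s (u ++ v) = res (res s u) v.
Proof. by elim: s => //= q s ->; rewrite act_cat_r /res1 foldl_cat. Qed.

Lemma act_cat_l s t u : act (s ++ t) u = act s (act t u).
Proof. exact: foldr_cat. Qed.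

Lemma res_cat_l s t u : res (s ++ t) u = res s (act t u) ++ res t u.
Proof. by elim: s => //= q s ->; rewrite act_cat_l. Qed.

Lemma size_act s u : size (act s u) = size u.
Proof.
have size_act1 q w : size (act1 q w) = size w.
  by elim: w q => //= a w IH q; rewrite IH.
by elim: s => //= q s <-.
Qed.

Lemma act_inf_prefix s (w : nat -> A) n :
  mkseq (act_inf s w) n = act s (mkseq w n).
Proof.
elim: n => [|n IH]; first by rewrite act_nil_r.
rewrite mkseqS IH /act_inf mkseqS -(cats1 (mkseq w n)) act_cat_r nth_cat size_act size_mkseq.
rewrite ltnn subnn.
have := size_act (res s (mkseq w n)) [:: w n].
by case: (act _ [:: w n]) => [|b []] //= _; rewrite cats1.
Qed.

End Mealy.

Section Words.
Variable A : finType.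

(* v^omega, for nonempty v *)
Definition omega (v : seq A) (hv : 0 < size v) : nat -> A :=
  fun n => tnth (in_tuple v) (Ordinal (ltn_pmod n hv)).

Definition cat_inf (u : seq A) (w : nat -> A) : nat -> A :=
  fun n => nth (w (n - size u)) u n.

Definition prefixes (X : (nat -> A) -> Prop) : seq A -> Prop :=
  fun p => exists x, X x /\ exists n, p = mkseq x n.

Record dfa := Dfa {
  dfa_state : finType;
  dfa_start : dfa_state;
  dfa_final : pred dfa_state;
  dfa_trans : dfa_state -> A -> dfa_state
}.

Definition dfa_accept (D : dfa) (p : seq A) : bool :=
  dfa_final (foldl (@dfa_trans D) (dfa_start D) p).

Definition regular (L : seq A -> Prop) : Prop :=
  exists D : dfa, forall p, L p <-> dfa_accept D p.

End Words.

(* Main.v *)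
Require Import Defs.
From mathcomp Require Import all_boot.
From mathcomp Require Import boolp.

Set Implicit Arguments.
Unset Strict Implicit.
Unset Printing Implicit Defensive.

(** Write [L w] for the set of prefixes of the orbit of an infinite word [w];
a word [p] is in [L w] when it lies in the orbit of the prefix of [w] of the
same length. By Myhill-Nerode it suffices that [L (u v^omega)] has finitely
many residuals, where the residual of [p] is the set of [y] with [p y] in the
language.

Fix [u] and [w], and for [x] in [L w] consider the fibre
[F x = {t | size t = size u, t x in L (u w)}]. Its cardinality depends only on
the length of [x] ([fiber_orb]): given a state [q] and a word [t],
reversibility gives a state [q'] with [q' @ t = q], so that
[q' . (t x) = (q' . t) (q . x)]; the map [t |-> q' . t] sends the fibre over
[x] into the fibre over [q . x], and it is injective because bi-reversibility
makes [(q', t) |-> (q' . t, q' @ t)] injective. Invertibility makes [x] and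
[q . x] play symmetric roles, so all fibres over words of one length are
equinumerous. On the other hand [F (x y)] is contained in [F x]. Hence the
common cardinality is nonincreasing in the length and eventually constant, and
from then on [F (x y) = F x]: for long [x], the residual of [t x] in
[L (u w)] is the residual of [x] in [L w] ([residual_drop]).

Taking [w = v^omega] and [u = v] shows that, in [L v^omega], the residual of a
word does not change when blocks of length [size v] are removed from its front
until it is short ([residual_drop_period]). Taking then an arbitrary [u], every
residual of [L (u v^omega)] is empty, or the residual of a short word, or the
residual in [L v^omega] of a short word: there are finitely many. *)

Lemma nonincreasing_nat_stable (f : nat -> nat) :
  (forall n, f n.+1 <= f n) -> exists N, forall n, N <= n -> f n = f N.
Proof.
move=> f_dec.
have f_mono m n : m <= n -> f n <= f m.
  by move/subnKC <-; elim: (n - m) => [|k IH]; rewrite ?addn0 // addnS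
    (leq_trans (f_dec _)).
have ex_val : exists v, `[< exists n, f n = v >].
  by exists (f 0); apply/asboolP; exists 0.
case: (ex_minnP ex_val) => _ /asboolP[N <-] minN.
exists N => n leNn; apply/eqP; rewrite eqn_leq f_mono //=.
by apply: minN; apply/asboolP; exists n.
Qed.

(** * Regularity from a finite invariant *)

(** The automaton runs on the values of the invariant, each of them standing
for an arbitrarily chosen word that realizes it. *)
Lemma regular_of_residual_invariant (A T : finType) (L : seq A -> Prop)
    (c : seq A -> T) :
  (forall p p', c p = c p' -> forall y, L (p ++ y) -> L (p' ++ y)) ->
  regular L.
Proof.
move=> cL.
pose rep t := if pselect (exists p, c p = t) is left h then sval (cid h)
              else [::].
have cK p : c (rep (c p)) = c p.
  rewrite /rep; case: pselect => [h|[]]; first exact: svalP (cid h).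
  by exists p.
pose D := @Dfa A T (c [::]) (fun t => `[< L (rep t) >])
               (fun t a => c (rcons (rep t) a)).
exists D => p; rewrite /dfa_accept /=.
suff run y : forall p, L (p ++ y) <->
    L (rep (foldl (@dfa_trans _ D) (c p) y)).
  by rewrite -[p]cat0s; apply: (iff_trans (run p [::])); split => /asboolP.
elim: y => [|a y IH] {}p /=.
  rewrite cats0; split => Lp.
    by rewrite -[rep _]cats0; apply: cL (esym (cK p)) _ _; rewrite cats0.
  by rewrite -[p]cats0; apply: cL (cK p) _ _; rewrite cats0.
apply: iff_trans (IH _); rewrite cat_rcons.
by split; apply: cL; rewrite cK.
Qed.

(** * Orbits of finite words *)

Section Orbits.
Variables (Q A : finType) (M : mealy Q A).

Definition orb (x y : seq A) : Prop := exists g, y = act M g x.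

Lemma orb_refl x : orb x x.
Proof. by exists [::]. Qed.

Lemma orb_trans x y z : orb x y -> orb y z -> orb x z.
Proof. by move=> [g ->] [h ->]; exists (h ++ g); rewrite act_cat_l. Qed.

Lemma orb_act1 q x : orb x (act1 M q x).
Proof. by exists [:: q]. Qed.

Lemma orb_catl s t s' t' : size s = size s' ->
  orb (s ++ t) (s' ++ t') -> orb s s'.
Proof.
move=> eq_sz [g /eqP]; rewrite act_cat_r eqseq_cat ?size_act //.
by case/andP=> /eqP -> _; exists g.
Qed.

Lemma orb_catr s t s' t' : size s = size s' ->
  orb (s ++ t) (s' ++ t') -> orb t t'.
Proof.
move=> eq_sz [g /eqP]; rewrite act_cat_r eqseq_cat ?size_act //.
by case/andP=> _ /eqP ->; exists (res M g s).
Qed.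

Lemma act1_inj q : invertible M -> injective (act1 M q).
Proof.
move=> invM x; elim: x q => [|a x IH] q [|b y] //= [].
by move/(bij_inj (invM q)) => <- /IH <-.
Qed.

(** [Q^*] is only a monoid, but a state permutes the words of a given length,
so one of its powers inverts it there. *)
Lemma orb_sym x y : invertible M -> orb x y -> orb y x.
Proof.
move=> invM [g ->] {y}; elim: g => [|q g IH]; first exact: orb_refl.
apply: orb_trans IH => /=; move: (act M g x) => {g}z.
have szP (t : (size z).-tuple A) : size (act1 M q t) == size z.
  by rewrite -[act1 M q t]/(act M [:: q] t) size_act size_tuple.
pose f t := Tuple (szP t).
have f_inj : injective f.
  by move=> s t /(congr1 val) /= /(act1_inj invM) /val_inj.
have valf k t : val (iter k f t) = iter k (act1 M q) t by elim: k => //= k ->.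
have actE k s : act M (nseq k q) s = iter k (act1 M q) s.
  by elim: k => //= k ->.
exists (nseq (order f (in_tuple z)).-1 q).
have /(congr1 val) := iter_order f_inj (in_tuple z).
by rewrite valf actE -iterSr prednK ?order_gt0.
Qed.

(** A state and a word are determined by the opposite corner of the rectangle
that they span, one square at a time. *)
Lemma act1_res1_inj q q' x x' : injective M -> size x = size x' ->
  act1 M q x = act1 M q' x' -> res1 M q x = res1 M q' x' -> q = q' /\ x = x'.
Proof.
move=> injM; elim: x x' q q' => [|a x IH] [|b x'] q q' //= [sz].
case=> eq_out eq_act eq_res; have [eq_step ->] := IH _ _ _ sz eq_act eq_res.
suff [-> ->] : (q, a) = (q', b) by [].
apply: injM; move: eq_out eq_step; rewrite /out /step.
by case: (M _) (M _) => [? ?] [? ?] /= -> ->.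
Qed.

Lemma res1_surj q x : reversible M -> exists q', res1 M q' x = q.
Proof.
move=> revM; elim/last_ind: x q => [|x a IH] q; first by exists q.
case: (revM a) => g _ gK; have [q' eq_q'] := IH (g q); exists q'.
by rewrite /res1 -cats1 foldl_cat -/(res1 M q' x) eq_q' /= gK.
Qed.

(** * Fibres over suffixes *)

Section Fibers.
Hypothesis bireM : bireversible M.

Definition fiber m (z x : seq A) : {set m.-tuple A} :=
  [set t : m.-tuple A | `[< orb z (t ++ x) >]].

Lemma fiberP m z x (t : m.-tuple A) :
  reflect (orb z (t ++ x)) (t \in fiber m z x).
Proof. by rewrite inE; apply: asboolP. Qed.

(** The injection is [t |-> q' . t] where [q'] is chosen with [q' @ t = q]. *)
Lemma leq_fiber_act1 m z q x :
  #|fiber m z x| <= #|fiber m z (act1 M q x)|.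
Proof.
have [_ revM /bij_inj injM] := bireM.
pose pre (t : m.-tuple A) := sval (cid (res1_surj q t revM)).
have preE t : res1 M (pre t) t = q by exact: (svalP (cid (res1_surj q t revM))).
have szP t : size (act1 M (pre t) t) == m.
  by rewrite -[act1 _ _ _]/(act M [:: pre t] t) size_act size_tuple.
pose f t := Tuple (szP t).
have f_inj : injective f.
  move=> s t /(congr1 val) /= eq_act; apply: val_inj => /=.
  have [||_ //] := act1_res1_inj injM _ eq_act.
    by rewrite !size_tuple.
  by rewrite !preE.
rewrite -(card_imset _ f_inj); apply/subset_leq_card/subsetP.
move=> _ /imsetP[t /fiberP zt ->]; apply/fiberP; apply: orb_trans zt _.
by rewrite -[in act1 M q x](preE t) -act1_cat; apply: orb_act1.
Qed.

Lemma fiber_orb m z x y : orb x y -> #|fiber m z x| = #|fiber m z y|.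
Proof.
have [invM _ _] := bireM.
have le_orb x' y' : orb x' y' -> #|fiber m z x'| <= #|fiber m z y'|.
  by case=> g ->; elim: g => //= q g /leq_trans -> //; apply: leq_fiber_act1.
by move=> xy; apply/eqP; rewrite eqn_leq !le_orb //; apply: orb_sym.
Qed.

(** * Residuals of the language of prefixes *)

Definition orbit_prefix (w : nat -> A) (p : seq A) : Prop :=
  orb (mkseq w (size p)) p.

Lemma prefixes_orbit_inf w p : prefixes (orbit_inf M w) p <-> orbit_prefix w p.
Proof.
split=> [[_ [[g ->] [n ->]]]|[g eq_p]].
  by rewrite /orbit_prefix size_mkseq act_inf_prefix; exists g.
exists (act_inf M g w); split; first by exists g.
by exists (size p); rewrite act_inf_prefix.
Qed.

Lemma mkseqD (w : nat -> A) m n :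
  mkseq w (m + n) = mkseq w m ++ mkseq (fun i => w (m + i)) n.
Proof.
by rewrite /mkseq iotaD map_cat add0n -[in iota m n](addn0 m) iotaDl -map_comp.
Qed.

Lemma mkseq_cat_inf u (w : nat -> A) n :
  mkseq (cat_inf u w) (size u + n) = u ++ mkseq w n.
Proof.
rewrite mkseqD; congr (_ ++ _).
  case: u => [|a u] //; apply: (@eq_from_nth _ a); rewrite size_mkseq //.
  by move=> i lti; rewrite nth_mkseq //; apply: set_nth_default.
apply: eq_mkseq => i; rewrite /cat_inf nth_default ?leq_addr //.
by rewrite addKn.
Qed.

Lemma eq_orbit_prefix w w' p :
  w =1 w' -> orbit_prefix w p -> orbit_prefix w' p.
Proof. by rewrite /orbit_prefix => /eq_mkseq ->. Qed.

Lemma orbit_prefix_catl w p y : orbit_prefix w (p ++ y) -> orbit_prefix w p.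
Proof.
by rewrite /orbit_prefix size_cat mkseqD; apply: orb_catl; rewrite size_mkseq.
Qed.

Lemma orbit_prefix_catr u w t x : size t = size u ->
  orbit_prefix (cat_inf u w) (t ++ x) -> orbit_prefix w x.
Proof.
move=> sz; rewrite /orbit_prefix size_cat sz mkseq_cat_inf.
exact/orb_catr/esym.
Qed.

(** A word [x] is long enough as soon as the cardinality of the fibres has
stopped decreasing at its length. *)
Lemma residual_drop u w : exists N, forall t x,
  size t = size u -> N <= size x -> orbit_prefix (cat_inf u w) (t ++ x) ->
  forall y, orbit_prefix (cat_inf u w) (t ++ x ++ y) <-> orbit_prefix w (x ++ y).
Proof.
pose F x := fiber (size u) (mkseq (cat_inf u w) (size u + size x)) x.
have FS x y : F (x ++ y) \subset F x.
  apply/subsetP=> t /fiberP; rewrite catA size_cat addnA mkseqD => tx.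
  by apply/fiberP; apply: orb_catl tx; rewrite size_mkseq size_cat size_tuple.
have FE x : orbit_prefix w x -> #|F x| = #|F (mkseq w (size x))|.
  by move=> /(fiber_orb (size u)) <-; rewrite /F size_mkseq.
have [n|N FN] := @nonincreasing_nat_stable (fun n => #|F (mkseq w n)|).
  by rewrite mkseqS -cats1; apply/subset_leq_card/FS.
exists N => t x szt leNx tx y.
split=> [|xy]; first exact: orbit_prefix_catr.
have [t' tE] : exists t' : (size u).-tuple A, t = t'.
  by exists (Tuple (introT eqP szt)).
have FP z : reflect (orbit_prefix (cat_inf u w) (t ++ z)) (t' \in F z).
  by rewrite /orbit_prefix size_cat szt tE; apply: fiberP.
suff eqF : F (x ++ y) = F x by apply/FP; rewrite eqF; apply/FP.
apply/eqP; rewrite eqEcard FS (FE _ xy) (FE _ (orbit_prefix_catl xy)) /=.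
by rewrite size_cat !FN // (leq_trans leNx) ?leq_addr.
Qed.

Lemma cat_inf_omega (v : seq A) (hv : 0 < size v) :
  cat_inf v (omega hv) =1 omega hv.
Proof.
move=> n; rewrite /cat_inf; have [ltn|len] := ltnP n (size v).
  by rewrite [RHS](tnth_nth (omega hv (n - size v))) /= [in RHS]modn_small.
rewrite nth_default // /omega; congr (tnth _ _); apply: val_inj => /=.
by rewrite -[in RHS](subnK len) modnDr.
Qed.

Lemma residual_drop_period (v : seq A) (hv : 0 < size v) : exists N, forall k x,
  k * size v + N <= size x -> orbit_prefix (omega hv) x ->
  forall y, orbit_prefix (omega hv) (x ++ y) <->
            orbit_prefix (omega hv) (drop (k * size v) x ++ y).
Proof.
have [N resN] := residual_drop v (omega hv); exists N.
have shift p : orbit_prefix (cat_inf v (omega hv)) p <-> orbit_prefix (omega hv) p.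
  by split; apply: eq_orbit_prefix => n; rewrite cat_inf_omega.
elim=> [|k IH] x lex; first by rewrite drop0.
rewrite mulSn in lex *; rewrite addnC -drop_drop -{1 2}(cat_take_drop (size v) x).
have szt : size (take (size v) x) = size v.
  by rewrite size_takel // (leq_trans _ lex) // -addnA leq_addr.
have szd : k * size v + N <= size (drop (size v) x).
  by rewrite size_drop leq_subRL ?addnA // -szt size_take geq_minr.
have leN : N <= size (drop (size v) x) by apply: leq_trans szd; rewrite leq_addl.
move=> /shift Lx y; rewrite -catA; apply: iff_trans (iff_sym (shift _)) _.
apply: iff_trans (resN _ _ szt leN Lx y) _.
by apply: IH => //; apply: orbit_prefix_catr Lx.
Qed.

(** The invariant of a word [p] in the language is [p] itself when [p] is
short; otherwise it is what remains after removing a word of length [size u]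
and as many blocks of length [size v] as [residual_drop_period] permits. *)
Lemma regular_orbit_prefix u v (hv : 0 < size v) :
  regular (orbit_prefix (cat_inf u (omega hv))).
Proof.
set L := orbit_prefix _.
have [N1 res1] := residual_drop u (omega hv).
have [N2 res2] := residual_drop_period hv.
pose B := size u + N1 + N2.
pose blocks (p : seq A) := (size p - size u - N2) %/ size v.
pose trim (p : seq A) := drop (blocks p * size v) (drop (size u) p).
pose long (p : seq A) := B <= size p.
pose c p := if `[< L p >] then
    Some (long p, insub_bseq (B + size v) (if long p then trim p else p))
  else None.
have trimL p y : long p -> L p ->
    L (p ++ y) <-> orbit_prefix (omega hv) (trim p ++ y).
  move=> lp Lp.
  have leu : size u <= size p by apply: leq_trans lp; rewrite /B -addnA leq_addr.
  have szt : size (take (size u) p) = size u by rewrite size_takel.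
  move: Lp; rewrite -{1 2}(cat_take_drop (size u) p) -catA => Lp.
  have leN1 : N1 <= size (drop (size u) p).
    by rewrite size_drop leq_subRL // (leq_trans _ lp) // leq_addr.
  apply: iff_trans (res1 _ _ szt leN1 Lp y) _.
  apply: res2; last exact: orbit_prefix_catr Lp.
  have le2 : N2 <= size (drop (size u) p).
    by rewrite size_drop leq_subRL // (leq_trans _ lp) // /B addnAC leq_addr.
  by rewrite addnC -leq_subRL // size_drop; apply: leq_divM.
have szB p : size (if long p then trim p else p) <= B + size v.
  case: ifPn => [lp|]; last first.
    by rewrite -ltnNge => /ltnW /leq_trans -> //; apply: leq_addr.
  rewrite /trim !size_drop /blocks; set s := size p - size u.
  have le_s : s <= N2 + (s - N2) by rewrite -leq_subLR.
  rewrite leq_subLR (leq_trans le_s) // {1}(divn_eq (s - N2) (size v)).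
  rewrite addnCA leq_add2l leq_add ?leq_addl //.
  by rewrite ltnW // ltn_pmod.
apply: (@regular_of_residual_invariant _ _ L c) => p p'; rewrite /c.
case: (asboolP (L p)) => [Lp|nLp]; last first.
  by move=> _ y /orbit_prefix_catl.
case: (asboolP (L p')) => [Lp'|] // [eq_long].
move=> /(congr1 val); rewrite /insub_bseq !val_insubd !szB -eq_long.
case: ifP => [lp eq_trim y|_ -> //].
move/(trimL _ _ lp Lp) => Lpy; apply/trimL => //; first by rewrite -eq_long.
by rewrite -eq_trim.
Qed.

End Fibers.
End Orbits.

Theorem proposition5p5 (Q A : finType) (M : mealy Q A) (hM : bireversible M)
    (u v : seq A) (hv : 0 < size v) :
  regular (prefixes (orbit_inf M (cat_inf u (omega hv)))).
Proof.
have [D DP] := regular_orbit_prefix hM u hv.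
by exists D => p; apply: iff_trans (prefixes_orbit_inf M _ p) (DP p).
Qed.
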